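(* Let $d,s\in\mathbb N$. Let $P_0:\mathbb R^d\to\mathbb R^d$ be a homogeneous polynomial of degree $m_0\in\{0,1,2,\dots\}$, and for $j=1,\dots,s$ let $n_j\in\mathbb N$, $\nu_j>0$, $p_j\in[1,\infty)$, and let $P_j:\mathbb R^d\to\mathbb R^{n_j}$ be a homogeneous polynomial of degree $m_j\in\mathbb N=\{1,2,\dots\}$. Define $$F(x)=\|P_1(x)\|_{p_1}^{\nu_1}\|P_2(x)\|_{p_2}^{\nu_2}\cdots\|P_s(x)\|_{p_s}^{\nu_s}\,P_0(x),\quad x\in\mathbb R^d,$$ and $\beta=m_0+\sum_{j=1}^sm_j\nu_j$. Suppose that, for $j=1,\dots,s$, the number $p_j$ is even, and the only solution $x\in\mathbb R^d$ of the equation $P_j(x)=0$ is $x=0$. Then: (i) $F\in\mathcal H_\beta(\mathbb R^d)\cap C(\mathbb R^d)\cap C^\infty(\mathbb R^d_0)$. (ii) If $\beta>1$, then $F\in\mathcal X^0$. (iii) Let $\bar\nu=\min\{\nu_j:j=1,\dots,s\}$ and assume $m_0+\bar\nu>1$. Then $F\in C^1(\mathbb R^d)$. Consequently, $F\in\mathcal X$.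
   Context: $\mathbb R^d_0=\mathbb R^d\setminus\{0\}$. $\|z\|_p=(\sum_{i=1}^n|z_i|^p)^{1/p}$ is the $\ell^p$-norm on $\mathbb R^n$; $|\cdot|$ is the Euclidean norm. A constant function, even zero, is considered a homogeneous polynomial of degree $0$. ''$f(x)=\mathcal O(h(x))$ as $x\to0$'' means there are $r,C>0$ with $|f(x)|\le Ch(x)$ for all $|x|<r$. $\mathcal H_\beta(\mathbb R^d)$ is the set of functions $G:\mathbb R^d\to\mathbb R^d$ with $G(tx)=t^\beta G(x)$ for all $x\in\mathbb R^d$, $t>0$. ''$G\in C^\infty(V)$'' means that $G$ restricted to the open set $V$ is infinitely differentiable. $\mathcal X$ (respectively $\mathcal X^0$) is the set of locally Lipschitz (respectively continuous) functions $F:\mathbb R^d\to\mathbb R^d$ for which one of the following holds: (E1) there exist numbers $\beta_k\in(1,\infty)$, $k\in\mathbb N$, strictly increasing to infinity, and $F_k\in\mathcal H_{\beta_k}(\mathbb R^d)\cap C^\infty(\mathbb R^d_0)$, $k\in\mathbb N$, such that for every $N\in\mathbb N$, $|F(x)-\sum_{k=1}^NF_k(x)|=\mathcal O(|x|^{\beta'})$ as $x\to0$ for some $\beta'>\beta_N$; or (E2) there exist $N_*\in\mathbb N$, strictly increasing $\beta_1,\dots,\beta_{N_*}\in(1,\infty)$ and $F_k\in\mathcal H_{\beta_k}(\mathbb R^d)\cap C^\infty(\mathbb R^d_0)$, $1\le k\le N_*$, such that $|F(x)-\sum_{k=1}^{N_*}F_k(x)|=\mathcal O(|x|^{\beta'})$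 as $x\to0$ for all $\beta'>\beta_{N_*}$. *)

(* Defs.v *)
From HB Require Import structures.
From mathcomp Require Import all_boot all_order all_algebra.
From mathcomp Require mpoly.
From mathcomp Require Import all_classical all_reals all_analysis.
Import numFieldNormedType.Exports.
(* Some notations of mpoly clash with those of MathComp-Analysis. *)
Import -(notations) mpoly.
Set Implicit Arguments.
Unset Strict Implicit.
Unset Printing Implicit Defensive.
Import Order.TTheory GRing.Theory Num.Theory.
Local Open Scope classical_set_scope.
Local Open Scope ring_scope.

(* The library norm `|x| on 'rV[R]_n is the maximum norm; this is the
   Euclidean one. *)
Definition enorm (R : realType) (n : nat) (x : 'rV[R]_n) : R :=
  Num.sqrt (\sum_(i < n) x 0 i ^+ 2).

Definition lpnorm (R : realType) (n : nat) (p : R) (z : 'rV[R]_n) : R :=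
  (\sum_(i < n) `|z 0 i| `^ p) `^ p^-1.

(* Zero components are allowed in every degree: the zero polynomial is
   homogeneous of any degree for ishomog1. *)
Definition hpoly (R : realType) (d n m : nat) (P : 'rV[R]_d -> 'rV[R]_n) :=
  forall i : 'I_n, exists2 q : mpoly d R,
    q \is ishomog1 m mdeg & forall x, P x 0 i = meval (x 0) q.

(* Class C^k on V, which is meant to be open: all partial derivatives of
   order at most k exist and are continuous on V. *)
Fixpoint Ck (R : realType) (d n k : nat) (V : set 'rV[R]_d)
    (G : 'rV[R]_d -> 'rV[R]_n) : Prop :=
  (forall x, V x -> {for x, continuous G}) /\
  match k with
  | 0 => True
  | k'.+1 => forall i : 'I_d,
      (forall x, V x -> derivable G x (delta_mx 0 i)) /\
      Ck k' V (fun x => 'D_(delta_mx 0 i) G x)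
  end.

Definition Cinfty (R : realType) (d n : nat) (V : set 'rV[R]_d)
    (G : 'rV[R]_d -> 'rV[R]_n) : Prop :=
  forall k, Ck k V G.

Definition punctured (R : realType) (d : nat) : set 'rV[R]_d :=
  [set x | x != 0].

Definition homog_class (R : realType) (d : nat) (beta : R)
    (G : 'rV[R]_d -> 'rV[R]_d) : Prop :=
  forall (x : 'rV[R]_d) (t : R), 0 < t -> G (t *: x) = t `^ beta *: G x.

Definition bigO0 (R : realType) (d : nat) (f h : 'rV[R]_d -> R) : Prop :=
  exists r C : R, [/\ 0 < r, 0 < C &
    forall x, enorm x < r -> `|f x| <= C * h x].

Definition loc_lipschitz (R : realType) (d : nat)
    (F : 'rV[R]_d -> 'rV[R]_d) : Prop :=
  forall x, exists r L : R, 0 < r /\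
    forall y z, enorm (y - x) < r -> enorm (z - x) < r ->
      enorm (F y - F z) <= L * enorm (y - z).

(* Infinite expansion; the index k here is k+1 in the usual numbering
   beta_1 < beta_2 < ..., so the sum below runs over the exponents up to
   and including beta N. *)
Definition expansion_E1 (R : realType) (d : nat)
    (F : 'rV[R]_d -> 'rV[R]_d) : Prop :=
  exists (beta : nat -> R) (Fk : nat -> 'rV[R]_d -> 'rV[R]_d),
    [/\ forall k, 1 < beta k,
        {homo beta : i j / (i < j)%N >-> i < j},
        beta k @[k --> \oo] --> +oo,
        forall k, homog_class (beta k) (Fk k) /\
                  Cinfty (@punctured R d) (Fk k)
      & forall N : nat, exists2 beta' : R, beta N < beta' &
          bigO0 (fun x => enorm (F x - \sum_(k < N.+1) Fk k x))
                (fun x => enorm x `^ beta')].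

(* Finite expansion with N.+1 >= 1 terms. *)
Definition expansion_E2 (R : realType) (d : nat)
    (F : 'rV[R]_d -> 'rV[R]_d) : Prop :=
  exists (N : nat) (beta : 'I_N.+1 -> R)
         (Fk : 'I_N.+1 -> 'rV[R]_d -> 'rV[R]_d),
    [/\ forall k, 1 < beta k,
        {homo beta : i j / (i < j)%N >-> i < j},
        forall k, homog_class (beta k) (Fk k) /\
                  Cinfty (@punctured R d) (Fk k)
      & forall beta' : R, beta ord_max < beta' ->
          bigO0 (fun x => enorm (F x - \sum_(k < N.+1) Fk k x))
                (fun x => enorm x `^ beta')].

Definition calX (R : realType) (d : nat) (F : 'rV[R]_d -> 'rV[R]_d) : Prop :=
  loc_lipschitz F /\ (expansion_E1 F \/ expansion_E2 F).

Definition calX0 (R : realType) (d : nat) (F : 'rV[R]_d -> 'rV[R]_d) : Prop :=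
  continuous F /\ (expansion_E1 F \/ expansion_E2 F).

(* Main.v *)
Require Import Defs.
From mathcomp Require Import all_boot all_order all_algebra.
From mathcomp Require Import all_classical all_reals all_analysis.
Import numFieldNormedType.Exports.
Import -(notations) mpoly.
Import Order.TTheory GRing.Theory Num.Theory.
Local Open Scope classical_set_scope.
Local Open Scope ring_scope.

Set Implicit Arguments.
Unset Strict Implicit.
Unset Printing Implicit Defensive.

(** Since p_j = 2k is even, `|z| `^ p_j is the polynomial z ^+ (2k), so
    lpnorm (p_j) (P_j x) `^ nu_j is the real power nu_j / p_j of a sum of even
    powers of polynomials in x.  That sum is positive away from 0, because
    P_j vanishes only at 0.  The scalar functions of class C^k on an open set
    contain the coordinates and are stable under sums, products and real
    powers of positive functions ([sCk_powR]), hence F is smooth on the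
    punctured space.  The homogeneity of F, of degree beta > 0, is direct.

    Everything that happens at the origin follows from homogeneity alone.  A
    map that is homogeneous of degree gamma and continuous off 0 is bounded by
    C |x|^gamma for some C, because it is bounded on the compact unit sphere
    ([homog_bound]).  With gamma = beta > 0 this gives the continuity of F at
    0.  If beta > 1, it shows moreover that all directional derivatives of F
    at 0 exist and vanish; as the partial derivatives of F are homogeneous of
    degree beta - 1 > 0 ([homog_derive]), the same bound makes them continuous
    at 0, so F is C^1 ([homog_C1]).  The condition m_0 + min nu_j > 1 of the
    last part implies beta > 1, since m_j >= 1 and there is at least one
    factor.

    A C^1 map is locally Lipschitz, by the mean value theorem applied along
    one coordinate at a time ([C1_lipschitz]), and a homogeneous map is its
    own one-term expansion, with remainder 0 ([homog_expansion]). *)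

(** * Scalar functions with continuous partial derivatives *)

(** The real-valued counterpart of [Ck]: unlike row vectors, real functions
    can be multiplied and raised to powers. *)
Fixpoint sCk (R : realType) (d k : nat) (V : set 'rV[R]_d)
    (f : 'rV[R]_d -> R) : Prop :=
  (forall x, V x -> {for x, continuous f}) /\
  match k with
  | 0 => True
  | k'.+1 => forall i : 'I_d,
      (forall x, V x -> derivable f x (delta_mx 0 i)) /\
      sCk k' V (fun x => 'D_(delta_mx 0 i) f x)
  end.

(** Reduces directional derivatives to one real variable, where the chain
    rule and the mean value theorem are available. *)
Lemma is_derive_lineP (R : realType) (U W : normedModType R) (f : U -> W)
    (x v : U) (s : R) (df : W) :
  is_derive s 1 (fun s => f (s *: v + x)) df <-> is_derive (s *: v + x) v f df.
Proof.
have quot : (fun h : R =>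
      h^-1 *: (((fun s => f (s *: v + x)) \o shift s) (h *: 1) -
               f (s *: v + x))) =
    (fun h => h^-1 *: ((f \o shift (s *: v + x)) (h *: v) - f (s *: v + x))).
  by apply/funext => h /=; rewrite [_ *: 1]mulr1 scalerDl addrA.
by split=> -[dl <-]; apply: DeriveDef;
  rewrite /derivable /derive ?quot// -?quot.
Qed.

Section ScalarSmooth.
Context {R : realType} {d : nat}.
Implicit Types (V : set 'rV[R]_d) (f g : 'rV[R]_d -> R).

Lemma sCk_cont k V f x : sCk k V f -> V x -> {for x, continuous f}.
Proof. by case: k => [|k] [cf _]; exact: cf. Qed.

Lemma sCkW k V f : sCk k.+1 V f -> sCk k V f.
Proof.
elim: k f => [|k IH] f [cf df]; split=> // i.
by have [? /IH ?] := df i.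
Qed.

(** Only the values on V matter because V is open: this lets the algebraic
    rules for derivatives, which hold on V only, be used under [sCk]. *)
Lemma eq_sCk k V f g : open V -> {in V, f =1 g} -> sCk k V f -> sCk k V g.
Proof.
move=> oV; have nfg (f' g' : 'rV[R]_d -> R) x :
    {in V, f' =1 g'} -> V x -> {near x, f' =1 g'}.
  move=> fg' Vx; have : nbhs x V by exact: open_nbhs_nbhs.
  by apply: filterS => y Vy; apply: fg'; rewrite inE.
have cfg (f' g' : 'rV[R]_d -> R) x : {in V, f' =1 g'} -> V x ->
    {for x, continuous f'} -> {for x, continuous g'}.
  move=> fg' Vx; rewrite /prop_for /continuous_at -fg' ?inE// => cf'.
  exact: cvg_trans (near_eq_cvg (nfg _ _ _ fg' Vx)) cf'.
elim: k f g => [|k IH] f g fg [cf df]; split=> //.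
- by move=> x Vx; exact: (cfg _ _ _ fg Vx (cf x Vx)).
- by move=> x Vx; exact: (cfg _ _ _ fg Vx (cf x Vx)).
move=> i; have [dfi ckdf] := df i; split=> [x Vx|].
  by apply: near_eq_derivable (dfi x Vx); exact: nfg.
apply: IH ckdf => x; rewrite inE => Vx; apply: near_eq_derive; exact: nfg.
Qed.

(** The induction step of all the stability properties below: it suffices to
    exhibit the partial derivatives on V. *)
Lemma sCkS k V f (df : 'I_d -> 'rV[R]_d -> R) : open V ->
  (forall x, V x -> {for x, continuous f}) ->
  (forall i x, V x -> is_derive x (delta_mx 0 i) f (df i x)) ->
  (forall i, sCk k V (df i)) -> sCk k.+1 V f.
Proof.
move=> oV cf hdf ck; split=> // i; split=> [x Vx|].
  by have [] := hdf i x Vx.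
apply: eq_sCk (ck i) => // x; rewrite inE => /(hdf i) h.
by rewrite derive_val.
Qed.

Lemma sCk_cst k V (c : R) : open V -> sCk k V (cst c).
Proof.
move=> oV; elim: k c => [|k IH] c.
  by split=> // x _; apply: cst_continuous.
apply: (@sCkS _ _ _ (fun=> cst 0)) => //.
by move=> x _; apply: cst_continuous.
Qed.

Lemma is_derive_coord (x v : 'rV[R]_d) (j : 'I_d) :
  is_derive x v (fun y : 'rV[R]_d => y 0 j) (v 0 j).
Proof.
have dj : differentiable (fun y : 'rV[R]_d => y 0 j : R) x.
  exact: differentiable_coord.
apply: DeriveDef; first exact: diff_derivable.
have vq : {near (0 : R)^', (fun=> v 0 j) =1
    (fun h => h^-1 *: ((h *: v + x) 0 j - x 0 j))}.
  near=> h; rewrite !mxE addrK [_ *: _]mulKf//.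
  by near: h; exact: nbhs_dnbhs_neq.
by apply: cvg_lim => //; exact: cvg_trans (near_eq_cvg vq) (cvg_cst _).
Unshelve. all: by end_near. Qed.

Lemma sCk_coord k V (j : 'I_d) : open V -> sCk k V (fun x => x 0 j).
Proof.
move=> oV; case: k => [|k].
  by split=> // x _; exact: coord_continuous.
apply: (@sCkS _ _ _ (fun i => cst (delta_mx 0 i 0 j))) => //.
- by move=> x _; exact: coord_continuous.
- by move=> i x _; exact: is_derive_coord.
- by move=> i; exact: sCk_cst.
Qed.

Lemma sCkD k V f g : open V -> sCk k V f -> sCk k V g ->
  sCk k V (fun x => f x + g x).
Proof.
move=> oV; elim: k f g => [|k IH] f g [cf df] [cg dg].
  by split=> // x Vx; exact: cvgD (cf x Vx) (cg x Vx).
apply: (@sCkS _ _ _ (fun i x => 'D_(delta_mx 0 i) f x + 'D_(delta_mx 0 i) g x)).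
- by [].
- by move=> x Vx; exact: cvgD (cf x Vx) (cg x Vx).
- move=> i x Vx; apply: is_deriveD; apply: derivableP.
  + exact: (df i).1.
  + exact: (dg i).1.
- by move=> i; apply: IH; [exact: (df i).2|exact: (dg i).2].
Qed.

Lemma sCkM k V f g : open V -> sCk k V f -> sCk k V g ->
  sCk k V (fun x => f x * g x).
Proof.
move=> oV; elim: k f g => [|k IH] f g Cf Cg.
  by split=> // x Vx; exact: cvgM (sCk_cont Cf Vx) (sCk_cont Cg Vx).
apply: (@sCkS _ _ _ (fun i x => f x * 'D_(delta_mx 0 i) g x
    + g x * 'D_(delta_mx 0 i) f x)) => //.
- by move=> x Vx; exact: cvgM (sCk_cont Cf Vx) (sCk_cont Cg Vx).
- move=> i x Vx; apply: is_deriveM; apply: derivableP.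
  + exact: (Cf.2 i).1.
  + exact: (Cg.2 i).1.
- move=> i; apply: sCkD => //; apply: IH.
  + exact: sCkW Cf.
  + exact: (Cg.2 i).2.
  + exact: sCkW Cg.
  + exact: (Cf.2 i).2.
Qed.

Lemma sCk_sum (I : Type) (r : seq I) k V (f : I -> 'rV[R]_d -> R) : open V ->
  (forall i, sCk k V (f i)) -> sCk k V (fun x => \sum_(i <- r) f i x).
Proof.
move=> oV Cf; elim: r => [|i r IH].
  apply: eq_sCk (sCk_cst k 0 oV) => // x _; by rewrite big_nil.
by apply: eq_sCk (sCkD oV (Cf i) IH) => // x _; rewrite big_cons.
Qed.

Lemma sCk_prod (I : Type) (r : seq I) k V (f : I -> 'rV[R]_d -> R) : open V ->
  (forall i, sCk k V (f i)) -> sCk k V (fun x => \prod_(i <- r) f i x).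
Proof.
move=> oV Cf; elim: r => [|i r IH].
  apply: eq_sCk (sCk_cst k 1 oV) => // x _; by rewrite big_nil.
by apply: eq_sCk (sCkM oV (Cf i) IH) => // x _; rewrite big_cons.
Qed.

Lemma sCkX k V f n : open V -> sCk k V f -> sCk k V (fun x => f x ^+ n).
Proof.
move=> oV Cf; elim: n => [|n IH]; first exact: sCk_cst.
by apply: eq_sCk (sCkM oV Cf IH) => // x _; rewrite exprS.
Qed.

Lemma is_derive_powR_comp f x v (a df : R) : 0 < f x ->
  is_derive x v f df ->
  is_derive x v (fun y => f y `^ a) (a * f x `^ (a - 1) * df).
Proof.
move=> f0 dfx; have /is_derive_lineP df0 : is_derive (0 *: v + x) v f df.
  by rewrite scale0r add0r.
have : is_derive (0 : R) 1
    ((fun y : R => y `^ a) \o (fun s : R => f (s *: v + x)))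
    (a * f x `^ (a - 1) * df).
  by apply: is_derive1_comp; rewrite scale0r add0r; exact: is_derive1_powR.
move/(is_derive_lineP (fun y => f y `^ a)).
by rewrite scale0r add0r.
Qed.

(** The induction on k has to treat all exponents at once, since the
    derivative of f `^ a involves f `^ (a - 1). *)
Lemma sCk_powR k V f (a : R) : open V -> (forall x, V x -> 0 < f x) ->
  sCk k V f -> sCk k V (fun x => f x `^ a).
Proof.
move=> oV f0.
have cpow k' : sCk k' V f ->
    forall b x, V x -> {for x, continuous (fun x => f x `^ b)}.
  move=> Cf b x Vx.
  apply: (@continuous_comp _ _ _ f (fun y : R => y `^ b) x).
    exact: sCk_cont Cf Vx.
  apply/differentiable_continuous/derivable1_diffP.
  by have [] := is_derive1_powR b (f0 x Vx).
elim: k a => [|k IH] a Cf.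
  by split=> //; exact: (cpow _ Cf).
apply: (@sCkS _ _ _
  (fun i x => a * f x `^ (a - 1) * 'D_(delta_mx 0 i) f x)) => //.
- exact: (cpow _ Cf).
- move=> i x Vx; apply: is_derive_powR_comp; first exact: f0.
  by apply: derivableP; exact: (Cf.2 i).1.
- move=> i; apply: sCkM => //; last exact: (Cf.2 i).2.
  apply: sCkM => //; first exact: sCk_cst.
  by apply: IH; exact: sCkW.
Qed.

End ScalarSmooth.

Lemma continuous_coords {R : realType} (d n : nat)
    (G : 'rV[R]_d -> 'rV[R]_n) x :
  (forall j, {for x, continuous (fun y => G y 0 j)}) -> {for x, continuous G}.
Proof.
move=> cG; apply/(@cvgrPdist_lt _ _ _ _ (nbhs_filter x)) => /= e e0.
have : \forall y \near nbhs x, forall j, `|G x 0 j - G y 0 j| < e.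
  apply: (@filter_forall _ _ _ (nbhs x) (nbhs_filter x)) => j.
  by have /cvgrPdist_lt := cG j; exact.
apply: filterS => y Gy.
rewrite [ltLHS]mx_normrE; apply/bigmax_ltP; split=> // -[i j] _ /=.
by rewrite (ord1 i) !mxE.
Qed.

Lemma Ck_coords {R : realType} (d n k : nat) V (G : 'rV[R]_d -> 'rV[R]_n) :
  open V -> (forall j, sCk k V (fun x => G x 0 j)) -> Ck k V G.
Proof.
move=> oV; elim: k G => [|k IH] G CG.
  split=> // x Vx; apply: continuous_coords => j; exact: sCk_cont (CG j) Vx.
split=> [x Vx|i].
  apply: continuous_coords => j; exact: sCk_cont (CG j) Vx.
have dG x : V x -> derivable G x (delta_mx 0 i).
  move=> Vx; apply/derivable_mxP => a j; rewrite (ord1 a).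
  exact: ((CG j).2 i).1.
split=> //; apply: IH => j.
apply: eq_sCk (((CG j).2 i).2) => // x; rewrite inE => Vx.
by rewrite derive_mx ?mxE//; exact: dG.
Qed.

(** * The punctured space and the norms on row vectors *)

Lemma open_punctured (R : realType) (d : nat) : open (@punctured R d).
Proof.
rewrite (_ : @punctured R d = ~` [set 0]); last first.
  by apply/seteqP; split=> x /= /eqP.
exact/closed_openC/(@accessible_closed_set1 _ (hausdorff_accessible _)).
Qed.

Lemma coord_le_norm (R : realType) n (x : 'rV[R]_n) i : `|x 0 i| <= `|x|.
Proof.
rewrite [leRHS]mx_normrE.
exact: (le_bigmax _ (fun ij => `|x ij.1 ij.2|) (0, i)).
Qed.

Lemma norm_le_coord (R : realType) n (x : 'rV[R]_n) (M : R) :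
  0 <= M -> (forall i, `|x 0 i| <= M) -> `|x| <= M.
Proof.
move=> M0 xM; rewrite [leLHS]mx_normrE; apply/bigmax_leP; split=> // -[i j] _.
by rewrite (ord1 i) xM.
Qed.

Lemma norm_le_enorm (R : realType) n (x : 'rV[R]_n) : `|x| <= enorm x.
Proof.
apply: norm_le_coord => [|i]; first exact: sqrtr_ge0.
rewrite -sqrtr_sqr; apply: ler_wsqrtr.
by rewrite (bigD1 i)//= lerDl sumr_ge0// => j _; exact: sqr_ge0.
Qed.

Lemma enorm_le_norm (R : realType) n (x : 'rV[R]_n) : enorm x <= n%:R * `|x|.
Proof.
rewrite -[leRHS]ger0_norm ?mulr_ge0// -sqrtr_sqr; apply: ler_wsqrtr.
apply: (@le_trans _ _ (\sum_(i < n) `|x| ^+ 2)).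
  apply: ler_sum => i _; rewrite -real_normK ?num_real//.
  by rewrite lerXn2r ?nnegrE// coord_le_norm.
rewrite sumr_const card_ord exprMn -[leLHS]mulr_natl; apply: ler_wpM2r => //.
by rewrite -natrX ler_nat; case: (n) => // k; rewrite leq_pmulr.
Qed.

(** * Homogeneous maps near the origin *)

Section Homogeneous.
Context {R : realType} {d : nat}.
Implicit Types (G : 'rV[R]_d -> 'rV[R]_d) (gamma : R).

(** By homogeneity `|G x| = `|x| `^ gamma * `|G (x / `|x|)|, and the last
    factor is bounded because the unit sphere is compact. *)
Lemma homog_bound gamma G : homog_class gamma G ->
  (forall x, x != 0 -> {for x, continuous G}) ->
  exists2 C : R, 0 < C & forall x, x != 0 -> `|G x| <= C * `|x| `^ gamma.
Proof.
move=> hG cG; pose S := [set x : 'rV[R]_d | `|x| = 1].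
have Snz x : S x -> x != 0.
  by rewrite /S /= -normr_gt0 => ->.
have cS : compact S.
  apply: bounded_closed_compact.
    exists 1; split; first exact: num_real.
    by move=> M M1 x; rewrite /S /= => ->; exact: ltW.
  apply: (@closed_comp _ _ (fun x : 'rV[R]_d => `|x|) [set 1]).
    by move=> x _; exact: norm_continuous.
  exact: closed_eq.
have Sunit x : x != 0 -> S (`|x|^-1 *: x).
  by move=> x0; rewrite /S /= normrZ normfV normr_id mulVf// normr_eq0.
have unitE x : x != 0 -> `|G x| = `|x| `^ gamma * `|G (`|x|^-1 *: x)|.
  move=> x0; have nx0 : 0 < `|x| by rewrite normr_gt0.
  rewrite -{1}[x]scale1r -(mulfV (lt0r_neq0 nx0)) -scalerA hG// normrZ.
  by rewrite ger0_norm ?powR_ge0.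
(* The sphere is empty in dimension 0, where there is no nonzero x either. *)
have [[y Sy]|noS] := pselect (S !=set0); last first.
  by exists 1 => // x /Sunit Sx; exfalso; apply: noS; eexists; exact: Sx.
have cN : {within S, continuous (fun x => `|G x|)}.
  apply: continuous_in_subspaceT => x; rewrite inE => /Snz x0.
  apply: (@continuous_comp _ _ _ G (fun z => `|z|) x); first exact: cG.
  exact: norm_continuous.
have [c _ maxc] := EVT_max_rV (ex_intro _ y Sy) cS cN.
(* The maximum |G c| is 0 when G vanishes on the sphere. *)
exists (`|G c| + 1); first by rewrite ltr_wpDl.
move=> x x0; rewrite (unitE _ x0) mulrC ler_wpM2r ?powR_ge0//.
apply: (le_trans (maxc _ _)); last by rewrite lerDl.
by rewrite inE; exact: Sunit.
Qed.

Lemma powR_small (C gamma e : R) : 0 < C -> 0 < gamma -> 0 < e ->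
  exists2 r, 0 < r & forall s, 0 <= s < r -> C * s `^ gamma < e.
Proof.
move=> C0 g0 e0; have eC0 : 0 < e / C by rewrite divr_gt0.
(* The value of s at which C * s `^ gamma = e. *)
exists ((e / C) `^ gamma^-1); first by rewrite powR_gt0.
move=> s /andP[s0 sr]; rewrite mulrC -ltr_pdivlMr//.
have -> : e / C = ((e / C) `^ gamma^-1) `^ gamma.
  by rewrite -powRrM mulVf ?gt_eqF// powRr1// ltW.
by apply: gt0_ltr_powR => //; rewrite nnegrE ?powR_ge0.
Qed.

Lemma bound_continuous0 C gamma G : 0 < C -> 0 < gamma -> G 0 = 0 ->
  (forall x, x != 0 -> `|G x| <= C * `|x| `^ gamma) ->
  {for 0, continuous G}.
Proof.
move=> C0 g0 G0 bG; apply/(@cvgrPdist_lt _ _ _ _ (nbhs_filter _)) => e e0.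
have [r r0 hr] := powR_small C0 g0 e0.
apply/nbhs_ballP; exists r => // y.
rewrite -ball_normE /= sub0r normrN G0 sub0r normrN.
move=> yr; have [->|y0] := eqVneq y 0; first by rewrite G0 normr0.
by apply: (le_lt_trans (bG _ y0)); apply: hr; rewrite normr_ge0.
Qed.

(** G 0 = G (2 *: 0) = 2 `^ gamma *: G 0, and 2 `^ gamma != 1. *)
Lemma homog0 gamma G : gamma != 0 -> homog_class gamma G -> G 0 = 0.
Proof.
move=> g0 hG; have := hG 0 2 (ltr0Sn _ _); rewrite scaler0 => /eqP.
rewrite -subr_eq0 -{1}[G 0]scale1r -scalerBl scaler_eq0 => /orP[|/eqP//].
rewrite subr_eq0 eq_sym powR_eq1 (negbTE g0) orbF => /orP[|].
  by rewrite pnatr_eq1.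
by rewrite ltNge ler0n.
Qed.

(** From G (h v + t x) = t^gamma G ((h / t) v + x): the difference quotient
    at t x with increment h is t^(gamma - 1) times the one at x with increment
    h / t. *)
Lemma homog_derive gamma G x v t : homog_class gamma G -> 0 < t ->
  derivable G x v ->
  is_derive (t *: x) v G (t `^ (gamma - 1) *: 'D_v G x).
Proof.
move=> hG t0 dG; have tn0 := lt0r_neq0 t0.
pose q (k : R) := k^-1 *: (G (k *: v + x) - G x).
have lq : q (t^-1 * h) @[h --> (0 : R)^'] --> 'D_v G x.
  apply: (@cvg_comp _ _ _ (fun h : R => t^-1 * h) q _ (0 : R)^' _ _ dG).
  move=> A [e e0 Ae]; exists (e * t) => /=; first exact: mulr_gt0.
  move=> h /=; rewrite sub0r normrN => he h0; apply: Ae => /=.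
    rewrite sub0r normrN normrM ger0_norm ?invr_ge0 ?ltW//.
    by rewrite mulrC ltr_pdivrMr.
  by rewrite mulf_neq0 ?invr_eq0.
have lG : h^-1 *: ((G \o shift (t *: x)) (h *: v) - G (t *: x))
    @[h --> (0 : R)^'] --> t `^ (gamma - 1) *: 'D_v G x.
  rewrite (_ : (fun h => _) = (fun h => t `^ (gamma - 1) *: q (t^-1 * h))).
    exact: cvgZl_tmp.
  apply/funext => h; rewrite /q /=.
  have -> : h *: v = t *: ((t^-1 * h) *: v) by rewrite scalerA mulVKf.
  rewrite -scalerDr !hG// -scalerBr !scalerA.
  congr (_ *: _).
  rewrite powRB ?tn0 ?implybT// powRr1 ?ltW// invfM invrK.
  by rewrite mulrA divfK// mulrC.
apply: DeriveDef; last exact: cvg_lim.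
by apply/cvg_ex; eexists; exact: lG.
Qed.

(** The difference quotient of G at 0 with increment h is at most
    C |v|^gamma |h|^(gamma - 1), which tends to 0. *)
Lemma bound_is_derive0 C gamma G v : 0 < C -> 1 < gamma -> G 0 = 0 ->
  (forall x, x != 0 -> `|G x| <= C * `|x| `^ gamma) ->
  is_derive 0 v G 0.
Proof.
move=> C0 g1 G0 bG.
have g0 : 0 < gamma by exact: lt_trans g1.
have lG : h^-1 *: ((G \o shift 0) (h *: v) - G 0) @[h --> (0 : R)^'] -->
    (0 : 'rV[R]_d).
  apply/cvgrPdist_lt => e e0.
  (* The summand 1 keeps the constant positive when v = 0. *)
  have D0 : 0 < C * `|v| `^ gamma + 1
    by rewrite ltr_wpDl// mulr_ge0 ?powR_ge0// ltW.
  have [r r0 hr] : exists2 r, 0 < r & forall s, 0 <= s < r ->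
      (C * `|v| `^ gamma + 1) * s `^ (gamma - 1) < e.
    by apply: powR_small => //; rewrite subr_gt0.
  exists r => //= h /=; rewrite !sub0r !normrN => hr' h0.
  rewrite addr0 G0 subr0 normrZ normfV.
  have nh0 : 0 < `|h| by rewrite normr_gt0.
  apply: le_lt_trans (hr `|h| _); last by rewrite normr_ge0.
  rewrite mulrC ler_pdivrMr// -mulrA [_ `^ _ * `|h|]mulrC mulr_powRB1//.
  have [->|hv0] := eqVneq (h *: v) 0.
    by rewrite G0 normr0 mulr_ge0 ?powR_ge0// ltW.
  apply: (le_trans (bG _ hv0)).
  rewrite normrZ powRM// mulrCA mulrC ler_wpM2r ?powR_ge0//.
  by rewrite lerDl.
apply: DeriveDef; last exact: cvg_lim.
by apply/cvg_ex; eexists; exact: lG.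
Qed.

(** The bound on G handles its derivative at 0; the bound on the partial
    derivatives, homogeneous of degree gamma - 1 > 0 and zero at 0, handles
    their continuity there. *)
Lemma homog_C1 gamma G : 1 < gamma -> homog_class gamma G ->
  Ck 1 (@punctured R d) G -> Ck 1 setT G.
Proof.
move=> g1 hG [cG dG]; have g0 : 0 < gamma by exact: lt_trans g1.
have G0 : G 0 = 0 by apply: homog0 hG; rewrite gt_eqF.
have [C C0 bG] := homog_bound hG cG.
have dG0 v : is_derive 0 v G 0 by apply: bound_is_derive0 bG.
split=> [x _|i].
  have [->|x0] := eqVneq x 0; last exact: cG.
  exact: bound_continuous0 bG.
pose e : 'rV[R]_d := delta_mx 0 i.
have De0 : 'D_e G 0 = 0 by have [] := dG0 e.
have derG x : derivable G x e.
  have [->|x0] := eqVneq x 0; first by have [] := dG0 e.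
  exact: (dG i).1.
split=> [x _|]; first exact: derG.
split=> // x _.
have hD : homog_class (gamma - 1) (fun x => 'D_e G x).
  by move=> y t t0; have [_ ->] := homog_derive hG t0 (derG y).
have cD y : y != 0 -> {for y, continuous (fun x => 'D_e G x)}.
  exact: (dG i).2.1.
have [D D0 bD] := homog_bound hD cD.
have [->|x0] := eqVneq x 0; last exact: cD.
by apply: bound_continuous0 bD; rewrite ?subr_gt0.
Qed.

End Homogeneous.

(** * Local Lipschitz continuity *)

Lemma bounded_derive_lipschitz (R : realType) (f df : R -> R) (c r M a b : R) :
  (forall s, `|s - c| < r -> is_derive s 1 f (df s)) ->
  (forall s, `|s - c| < r -> `|df s| <= M) ->
  `|a - c| < r -> `|b - c| < r -> `|f b - f a| <= M * `|b - a|.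
Proof.
move=> fdf dfM; wlog ab : a b / a <= b => [H ar br|].
  have [ab|/ltW ba] := leP a b; first exact: H ab ar br.
  rewrite distrC [`|b - a|]distrC; exact: H ba br ar.
rewrite !ltr_norml => /andP[ar1 ar2] /andP[br1 br2].
have abr s : s \in `[a, b] -> `|s - c| < r.
  rewrite in_itv /= => /andP[sa sb]; rewrite ltr_norml.
  by rewrite (lt_le_trans ar1) ?lerD2r//= (le_lt_trans _ br2) ?lerD2r.
have [s||s sab ->] := @MVT_segment R f df a b ab.
- by move=> sab; apply/fdf/abr/subset_itv_oo_cc.
- apply: derivable_within_continuous => s sab.
  by have [] := fdf s (abr _ sab).
- by rewrite normrM ler_wpM2r// dfM// abr.
Qed.

(** Balls for the maximum norm are boxes: one goes from z to y inside the box
    by changing the coordinates one after the other, and applies the mean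
    value theorem to every component of G on each of these d segments. *)
Lemma C1_lipschitz (R : realType) (d n : nat) (G : 'rV[R]_d -> 'rV[R]_n) :
  Ck 1 setT G -> forall x, exists r L : R, [/\ 0 < r, 0 <= L &
    forall y z, `|y - x| < r -> `|z - x| < r -> `|G y - G z| <= L * `|y - z|].
Proof.
move=> [_ dG] x.
pose D i y := 'D_(delta_mx 0 i) G y.
pose M := \sum_i (`|D i x| + 1).
have M0 : 0 <= M by apply: sumr_ge0 => i _; rewrite addr_ge0.
have : \forall y \near nbhs x, forall i, `|D i y| <= M.
  apply: (@filter_forall _ _ _ (nbhs x) (nbhs_filter x)) => i.
  have /(@cvgrPdist_lt _ _ _ _ (nbhs_filter x)) := (dG i).2.1 x I.
  move=> /(_ 1 ltr01); apply: filterS => y Dxy.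
  apply: (@le_trans _ _ (`|D i x| + 1)).
    rewrite -lerBlDl; apply: le_trans (lerB_dist _ _) _.
    by rewrite distrC ltW.
  rewrite /M (bigD1 i)//= lerDl sumr_ge0// => j _; by rewrite addr_ge0.
move=> /nbhs_ballP[r /= r0 xr]; exists r, (d%:R * M); split=> //.
  by rewrite mulr_ge0.
move=> y z yr zr.
(* The corners of the path: the first k coordinates are already those of y. *)
pose w k : 'rV[R]_d := \row_i if (i < k)%N then y 0 i else z 0 i.
have step k : (k <= d)%N -> `|G (w k) - G (w 0)| <= k%:R * M * `|y - z|.
  elim: k => [|k IH] kd; first by rewrite subrr normr0 !mul0r.
  pose i := Ordinal kd.
  pose u : 'rV[R]_d := \row_j if j == i then 0 else w k 0 j.
  have wk : w k = z 0 i *: delta_mx 0 i + u.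
    apply/rowP => j; rewrite !mxE /=; have [->|ji] := eqVneq j i.
      by rewrite ltnn mulr1 addr0.
    by rewrite mulr0 add0r.
  have wk1 : w k.+1 = y 0 i *: delta_mx 0 i + u.
    apply/rowP => j; rewrite !mxE /=; have [->|ji] := eqVneq j i.
      by rewrite ltnSn mulr1 addr0.
    rewrite mulr0 add0r ltnS leq_eqVlt; suff -> : (j == k :> nat) = false by [].
    by apply: contra_neqF ji => /eqP jk; exact: val_inj.
  have line s : `|s - x 0 i| < r -> `|s *: delta_mx 0 i + u - x| < r.
    move=> sr; rewrite [ltLHS]mx_normrE.
    apply/bigmax_ltP; split=> // -[a j] _ /=.
    rewrite (ord1 a) !mxE /=; have [->|ji] := eqVneq j i.
      by rewrite mulr1 addr0.
    rewrite mulr0 add0r; case: ifP => _.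
      by apply: le_lt_trans yr; have := coord_le_norm (y - x) j; rewrite !mxE.
    by apply: le_lt_trans zr; have := coord_le_norm (z - x) j; rewrite !mxE.
  have stepi : `|G (w k.+1) - G (w k)| <= M * `|y - z|.
    apply: norm_le_coord => [|j]; first by rewrite mulr_ge0.
    apply: (@le_trans _ _ (M * `|y 0 i - z 0 i|)); last first.
      by rewrite ler_wpM2l//; have := coord_le_norm (y - z) i; rewrite !mxE.
    rewrite wk wk1 !mxE.
    apply: (@bounded_derive_lipschitz R (fun s => G (s *: delta_mx 0 i + u) 0 j)
      (fun s => D i (s *: delta_mx 0 i + u) 0 j) (x 0 i) r M).
    - move=> s sr; apply/(is_derive_lineP (fun y => G y 0 j)).
      have dGs := (dG i).1 (s *: delta_mx 0 i + u) I.
      apply: DeriveDef; first by move/derivable_mxP : dGs; exact.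
      by rewrite /D derive_mx ?mxE.
    - move=> s /line sr; apply: (le_trans (coord_le_norm _ _)).
      by apply: xr; rewrite -ball_normE /= distrC.
    - by apply: le_lt_trans zr; have := coord_le_norm (z - x) i; rewrite !mxE.
    - by apply: le_lt_trans yr; have := coord_le_norm (y - x) i; rewrite !mxE.
  rewrite -(subrKA (G (w k))); apply: (le_trans (ler_normD _ _)).
  rewrite -natr1 !mulrDl mul1r addrC lerD//; exact/IH/ltnW.
have wd : w d = y by apply/rowP => i; rewrite mxE ltn_ord.
have w0 : w 0%N = z by apply/rowP => i; rewrite mxE.
by have := step d (leqnn d); rewrite wd w0.
Qed.

Lemma C1_loc_lipschitz (R : realType) (d : nat) (G : 'rV[R]_d -> 'rV[R]_d) :
  Ck 1 setT G -> loc_lipschitz G.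
Proof.
move=> /C1_lipschitz lG x; have [r [L [r0 L0 lip]]] := lG x.
exists r, (d%:R * L); split=> // y z yr zr.
apply: (le_trans (enorm_le_norm _)); rewrite -mulrA ler_wpM2l//.
apply: (le_trans (lip y z _ _)); rewrite ?(le_lt_trans (norm_le_enorm _))//.
by rewrite ler_wpM2l// norm_le_enorm.
Qed.

(** * The product of powers of norms *)

(** With the single term G the remainder is identically 0. *)
Lemma homog_expansion (R : realType) (d : nat) (beta : R)
    (G : 'rV[R]_d -> 'rV[R]_d) :
  1 < beta -> homog_class beta G -> Cinfty (@punctured R d) G ->
  expansion_E2 G.
Proof.
move=> b1 hG CG; exists 0%N, (fun=> beta), (fun=> G); split=> //.
- by move=> i j; rewrite (ord1 i) (ord1 j).
- move=> b' _; exists 1, 1; split=> // x _.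
  rewrite big_ord1 subrr mul1r /enorm big1 => [|i _].
    by rewrite sqrtr0 normr0 powR_ge0.
  by rewrite mxE expr0n.
Qed.

Lemma hpolyZ (R : realType) (d n m : nat) (P : 'rV[R]_d -> 'rV[R]_n) t x :
  hpoly m P -> P (t *: x) = t ^+ m *: P x.
Proof.
move=> hP; apply/rowP => i; rewrite mxE; have [q /mpoly.dhomogP hq PE] := hP i.
rewrite !PE !mpoly.mevalE mulr_sumr; apply: eq_big_seq => a /hq <-.
rewrite mulrCA; congr (_ * _); rewrite /= mdegE -prodrXr -big_split /=.
by apply: eq_bigr => j _; rewrite mxE exprMn.
Qed.

Lemma hpoly_sCk (R : realType) (d n m : nat) (P : 'rV[R]_d -> 'rV[R]_n) k V i :
  open V -> hpoly m P -> sCk k V (fun x => P x 0 i).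
Proof.
move=> oV hP; have [q _ PE] := hP i.
have Cq : sCk k V (fun x => mpoly.meval (x 0) q).
  rewrite (_ : (fun x => _) = fun x : 'rV[R]_d => \sum_(a <- mpoly.msupp q)
      mpoly.mcoeff a q * \prod_(j < d) x 0 j ^+ a j).
    apply: sCk_sum => // a; apply: sCkM => //; first exact: sCk_cst.
    by apply: sCk_prod => // j; apply: sCkX => //; exact: sCk_coord.
  by apply/funext => x; rewrite mpoly.mevalE.
by apply: eq_sCk Cq => // x _; rewrite PE.
Qed.

Lemma lpnorm_evenE (R : realType) (n k : nat) (nu : R) (z : 'rV[R]_n) :
  lpnorm (2 * k)%:R z `^ nu =
  (\sum_(i < n) z 0 i ^+ (2 * k)) `^ ((2 * k)%:R^-1 * nu).
Proof.
rewrite /lpnorm -powRrM; congr (_ `^ _); apply: eq_bigr => i _.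
by rewrite powR_mulrn// !exprM real_normK ?num_real.
Qed.

Lemma sum_even_gt0 (R : realType) (n k : nat) (z : 'rV[R]_n) :
  z != 0 -> 0 < \sum_(i < n) z 0 i ^+ (2 * k).
Proof.
move=> z0; have zi0 i : 0 <= z 0 i ^+ (2 * k).
  by rewrite exprM exprn_ge0 ?sqr_ge0.
rewrite lt_neqAle sumr_ge0// andbT eq_sym; apply: contra z0.
rewrite psumr_eq0// => /allP h; apply/eqP/rowP => i; rewrite mxE.
by have := h i (mem_index_enum i); rewrite expf_eq0 => /andP[_ /eqP].
Qed.

Lemma lpnormZ (R : realType) (n : nat) (p t : R) (z : 'rV[R]_n) :
  p != 0 -> 0 <= t -> lpnorm p (t *: z) = t * lpnorm p z.
Proof.
move=> p0 t0; rewrite /lpnorm.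
under eq_bigr do rewrite mxE normrM ger0_norm// powRM//.
rewrite -mulr_sumr powRM ?powR_ge0 ?sumr_ge0//.
by rewrite -powRrM mulfV// powRr1.
Qed.

Lemma powR_sum (R : realType) (I : Type) (r : seq I) (t : R) (a : I -> R) :
  0 < t -> t `^ (\sum_(i <- r) a i) = \prod_(i <- r) t `^ a i.
Proof.
move=> t0; elim: r => [|i r IH]; first by rewrite !big_nil powRr0.
by rewrite !big_cons powRD ?IH// (gt_eqF t0) implybT.
Qed.

Theorem theorem6p5 (R : realType) (d s : nat) (hd : (0 < d)%N) (hs : (0 < s)%N)
    (m0 : nat) (P0 : 'rV[R]_d -> 'rV[R]_d) (hP0 : hpoly m0 P0)
    (n m : 'I_s -> nat) (nu p : 'I_s -> R)
    (P : forall j : 'I_s, 'rV[R]_d -> 'rV[R]_(n j))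
    (hn : forall j, (0 < n j)%N) (hm : forall j, (0 < m j)%N)
    (hnu : forall j, 0 < nu j) (hp : forall j, 1 <= p j)
    (hP : forall j, hpoly (m j) (P j))
    (peven : forall j, exists k : nat, p j = (2 * k)%:R)
    (Pnondeg : forall j x, P j x = 0 <-> x = 0) :
  let F := fun x : 'rV[R]_d =>
    (\prod_(j < s) lpnorm (p j) (P j x) `^ nu j) *: P0 x in
  let beta := m0%:R + \sum_(j < s) (m j)%:R * nu j in
  let nubar := \big[Num.min/nu (Ordinal hs)]_(j < s) nu j in
  [/\ [/\ homog_class beta F, continuous F & Cinfty (@punctured R d) F],
      1 < beta -> calX0 F
    & 1 < m0%:R + nubar -> Ck 1 setT F /\ calX F].
Proof.
move=> F beta nubar.
have oV := @open_punctured R d.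
have hF : homog_class beta F.
  move=> x t t0; rewrite /F (hpolyZ t x hP0) [LHS]scalerA [RHS]scalerA.
  congr (_ *: _).
  have -> : t `^ beta = (\prod_(j < s) t `^ ((m j)%:R * nu j)) * t ^+ m0.
    rewrite mulrC -powR_mulrn ?ltW// /beta powRD ?(gt_eqF t0) ?implybT//.
    by congr (_ * _); exact: powR_sum.
  rewrite [RHS]mulrAC -big_split /=; congr (_ * _); apply: eq_bigr => j _.
  rewrite (hpolyZ t x (hP j)) lpnormZ ?exprn_ge0 ?gt_eqF ?ltW//; last first.
    exact: lt_le_trans (hp j).
  by rewrite powRM ?powR_ge0 ?exprn_ge0 ?ltW// -powR_mulrn ?ltW// -powRrM.
have smF : Cinfty (@punctured R d) F.
  move=> k; apply: Ck_coords => // i.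
  have Cpow j : sCk k (@punctured R d) (fun x => lpnorm (p j) (P j x) `^ nu j).
    have [l pE] := peven j.
    rewrite (_ : (fun x => _) = (fun x => (\sum_(i < n j) P j x 0 i ^+ (2 * l))
        `^ ((2 * l)%:R^-1 * nu j))); last first.
      by apply/funext => x; rewrite pE lpnorm_evenE.
    apply: sCk_powR => //.
      move=> x /eqP x0; apply: sum_even_gt0; apply/eqP => /Pnondeg; exact: x0.
    by apply: sCk_sum => // a; apply: sCkX => //; exact: hpoly_sCk (hP j).
  have CF := sCkM oV (sCk_prod (index_enum _) oV Cpow) (hpoly_sCk k i oV hP0).
  by apply: eq_sCk CF => // x _; rewrite /F mxE.
have nuE j : nu j <= (m j)%:R * nu j.
  by apply: ler_peMl; rewrite ?ler1n ?hm // ltW.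
have beta_ge : m0%:R + nubar <= beta.
  rewrite lerD2l (bigD1 (Ordinal hs))//=.
  apply: (@le_trans _ _ (nu (Ordinal hs))); first exact: bigmin_le_id.
  apply: (le_trans (nuE _)); rewrite lerDl sumr_ge0// => j _.
  by apply: mulr_ge0 => //; exact: ltW.
have beta0 : 0 < beta.
  rewrite ltr_wpDl// (bigD1 (Ordinal hs))//= ltr_pwDl//.
    by rewrite mulr_gt0 ?ltr0n.
  by rewrite sumr_ge0// => j _; apply: mulr_ge0 => //; exact: ltW.
have cF : continuous F.
  move=> x; have [->|x0] := eqVneq x 0; last exact: (smF 0%N).1.
  have [C C0 bF] := homog_bound hF (smF 0%N).1.
  by apply: bound_continuous0 bF => //; apply: homog0 hF; rewrite gt_eqF.
split=> // [b1|b1].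
  by split=> //; right; exact: homog_expansion hF smF.
have {}b1 : 1 < beta by exact: lt_le_trans beta_ge.
have C1F := homog_C1 b1 hF (smF 1%N).
split=> //; split; first exact: C1_loc_lipschitz.
by right; exact: homog_expansion hF smF.
Qed.
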